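(* For any real numbers $x,y$ with $\frac{x}{x+y}\geq 0$ and any $n\in\mathbb{N}=\{1,2,3,\ldots\}$, both of the following identities hold: $$\sum_{k=0}^n x^k y^{n-k}\binom{n}{k}H_k^{(2)}=(x+y)^n\left\{\sum_{j=1}^n \frac{y^j(x+y)^{-j}}{j}\sum_{i=1}^j \frac{y^{-i}(x+y)^i}{i}-\sum_{j=1}^n \frac{y^j(x+y)^{-j}}{j}H_j\right\},$$ and $$\sum_{k=0}^n x^k y^{n-k}\binom{n}{k}H_k^2=(x+y)^n\left\{H_n^2+H_n^{(2)}-2\sum_{j=1}^n \frac{y^j(x+y)^{-j}}{j^2}-2H_n\sum_{j=1}^n \frac{y^j(x+y)^{-j}}{j}+3\sum_{j=1}^n \frac{y^j(x+y)^{-j}}{j}H_j-\sum_{j=1}^n \frac{y^j(x+y)^{-j}}{j}\sum_{i=1}^j \frac{y^{-i}(x+y)^i}{i}\right\}.$$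
   Context: Harmonic numbers: $H_n=\sum_{j=1}^n \frac1j$ and $H_n^{(2)}=\sum_{j=1}^n\frac{1}{j^2}$, with $H_0=H_0^{(2)}=0$. Here $H_k^2=(H_k)^2$. In the double sums the product $y^j y^{-i}$ (with $1\le i\le j$) is read as $y^{j-i}$, and $0^0=1$, so that the expressions make sense also when $y=0$. *)

(* Defs.v *)
From HB Require Import structures.
From mathcomp Require Import all_boot all_order all_algebra.
From mathcomp Require Import reals.

Set Implicit Arguments.
Unset Strict Implicit.
Unset Printing Implicit Defensive.

Import Order.TTheory GRing.Theory Num.Theory.
Local Open Scope ring_scope.

Definition harmonic_num (R : realType) (n : nat) : R :=
  \sum_(1 <= j < n.+1) j%:R^-1.

Definition harmonic_num2 (R : realType) (n : nat) : R :=
  \sum_(1 <= j < n.+1) (j%:R ^+ 2)^-1.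

(* The double sum
     \sum_(1 <= j <= n) y^j s^(-j) / j * \sum_(1 <= i <= j) y^(-i) s^i / i
   where y^j * y^(-i) is read as y^(j - i), with 0^0 = 1. The factor y^j has to
   be moved into the inner sum because y may be 0; as i <= j there, the natural
   number subtraction is not truncated. *)
Definition double_sum (R : realType) (y s : R) (n : nat) : R :=
  \sum_(1 <= j < n.+1) (s ^- j / j%:R *
    \sum_(1 <= i < j.+1) (y ^+ (j - i) * s ^+ i / i%:R)).

(* Main.v *)
Require Import Defs.
From HB Require Import structures.
From mathcomp Require Import all_boot all_order all_algebra.
From mathcomp Require Import reals.
From mathcomp Require Import ring.

Set Implicit Arguments.
Unset Strict Implicit.
Unset Printing Implicit Defensive.

Import Order.TTheory GRing.Theory Num.Theory.
Local Open Scope ring_scope.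

(** Write s = x + y and T f n for the sum of C(n, k) x^k y^(n - k) f(k) over
    k <= n. Pascal's rule gives T f (n + 1) = s T f n + x T (Df) n, where
    Df(k) = f(k + 1) - f(k), and the absorption rule
    C(n, k) / (k + 1) = C(n + 1, k + 1) / (n + 1) gives
    x T (k |-> g(k + 1) / (k + 1)) n = T g (n + 1) / (n + 1) whenever g(0) = 0.
    So if f(0) = g(0) = 0 and Df(k) = g(k + 1) / (k + 1), the sequence T f solves
    a first order linear recurrence, and unrolling it yields
      T f n = s^n * sum_(1 <= j <= n) s^(-j) / j * T g j
    (lemma [binom_sum_antidifference]).

    The three functions H, H^(2) and H^2 are of this kind, with g(k) equal to
    [k > 0], 1/k and 2 H_k - 1/k respectively; the last one because
    H_(k+1)^2 - H_k^2 = (2 H_(k+1) - 1/(k+1)) / (k+1). The transform of [k > 0]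
    is s^n - y^n by the binomial theorem, and that of 1/k satisfies a recurrence
    again, now with ratio y ([binom_sum_inv]): this is where the inner sum of
    the double sum comes from. The first identity is then immediate. In the
    second one, the terms of the form sum_j 1/j sum_(i <= j) a_i / i have to be
    rewritten by exchanging the two summations; this is done, all at once, by
    comparing the increments of both sides in n ([harmonic_sum_rearrange]). *)

(** * Binomial transforms *)

Definition binom_sum (R : numFieldType) (x y : R) (f : nat -> R) (n : nat) : R :=
  \sum_(0 <= k < n.+1) x ^+ k * y ^+ (n - k) * 'C(n, k)%:R * f k.

Section BinomialTransform.
Variables (R : numFieldType) (x y : R).
Implicit Types (f g : nat -> R) (n : nat).
Local Notation T := (binom_sum x y).

Lemma eq_binom_sum f g n : f =1 g -> T f n = T g n.
Proof. by move=> efg; apply: eq_bigr => k _; rewrite efg. Qed.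

Lemma binom_sumB f g n : T (fun k => f k - g k) n = T f n - T g n.
Proof. by rewrite /binom_sum -sumrB; apply: eq_bigr => k _; rewrite mulrBr. Qed.

Lemma binom_sumZ (c : R) f n : T (fun k => c * f k) n = c * T f n.
Proof. by rewrite /binom_sum mulr_sumr; apply: eq_bigr => k _; rewrite mulrCA. Qed.

Lemma binom_sum0 f : T f 0 = f 0%N.
Proof. by rewrite /binom_sum big_nat1 subnn !expr0 bin0 !mul1r. Qed.

Lemma binom_sum_pascal f n :
  T f n.+1 = y * T f n + x * T (fun k => f k.+1) n.
Proof.
rewrite /binom_sum big_nat_recl // bin0.
under eq_bigr => k _ do rewrite binS natrD mulrDr mulrDl subSS.
rewrite big_split /= addrA; congr (_ + _); last first.
  by rewrite mulr_sumr; apply: eq_bigr => k _; rewrite exprS !mulrA.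
(* The last term of the shifted sum carries C(n, n + 1) = 0. *)
rewrite [\sum_(0 <= i < n.+1) _]big_nat_recr //= bin_small // mulr0 mul0r addr0.
rewrite [in RHS]big_nat_recl // bin0 mulrDr !subn0 exprS !mulrA mulr_sumr.
congr (_ + _); first by ring.
rewrite !big_mkord; apply: eq_bigr => k _.
by rewrite -(subnSK (ltn_ord k)) [y ^+ _.+1]exprS; ring.
Qed.

Lemma binom_sum_diff f n :
  T f n.+1 = (x + y) * T f n + x * T (fun k => f k.+1 - f k) n.
Proof. by rewrite binom_sum_pascal binom_sumB; ring. Qed.

Lemma binom_sum_absorb g n : g 0%N = 0 ->
  x * T (fun k => g k.+1 / k.+1%:R) n = T g n.+1 / n.+1%:R.
Proof.
move=> g0; rewrite /binom_sum [in RHS]big_nat_recl // g0 mulr0 add0r.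
rewrite mulr_sumr mulr_suml; apply: eq_bigr => k _.
have binE : n.+1%:R * 'C(n, k)%:R = k.+1%:R * 'C(n.+1, k.+1)%:R :> R.
  by rewrite -!natrM mul_bin_diag.
have n0 : n.+1%:R != 0 :> R by rewrite pnatr_eq0.
have k0 : k.+1%:R != 0 :> R by rewrite pnatr_eq0.
have -> : 'C(n, k)%:R = k.+1%:R * 'C(n.+1, k.+1)%:R / n.+1%:R :> R.
  by rewrite -binE mulrC mulKf.
rewrite subSS exprS.
transitivity (x * x ^+ k * y ^+ (n - k) * 'C(n.+1, k.+1)%:R * g k.+1 / n.+1%:R
              * (k.+1%:R / k.+1%:R)); first by ring.
by rewrite divff // mulr1.
Qed.

Lemma binom_sum1 n : T (fun=> 1) n = (x + y) ^+ n.
Proof.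
elim: n => [|n IHn]; first by rewrite binom_sum0.
by rewrite binom_sum_pascal IHn exprS -mulrDl addrC.
Qed.

(** The k = 0 term of the binomial expansion of (x + y)^n, which this sum
    omits, is y^n. *)
Lemma binom_sum_pos n : T (fun k => (0 < k)%:R) n = (x + y) ^+ n - y ^+ n.
Proof.
elim: n => [|n IHn]; first by rewrite binom_sum0 subrr.
by rewrite binom_sum_pascal IHn binom_sum1 !exprS; ring.
Qed.

(** Pascal's rule and absorption make this transform satisfy a recurrence of
    ratio y with inhomogeneous term ((x + y)^n - y^n) / n. At k = 0 the summand
    vanishes because 0^-1 = 0. *)
Lemma binom_sum_inv n :
  T (fun k => k%:R^-1) n =
  \sum_(1 <= i < n.+1) y ^+ (n - i) * ((x + y) ^+ i - y ^+ i) / i%:R.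
Proof.
elim: n => [|n IHn]; first by rewrite binom_sum0 invr0 big_geq.
rewrite binom_sum_pascal IHn [in RHS]big_nat_recr //= subnn expr0 mul1r.
congr (_ + _).
  rewrite mulr_sumr; apply: eq_big_nat => i /andP[_ lti].
  by rewrite subSn // exprS !mulrA.
rewrite -binom_sum_pos -binom_sum_absorb //; congr (_ * _).
by apply: eq_binom_sum => k; rewrite mul1r.
Qed.

(** By absorption, [binom_sum_diff] for f is the linear recurrence
    T f (n + 1) = (x + y) T f n + T g (n + 1) / (n + 1), which is solved by
    dividing by (x + y)^n and telescoping. *)
Lemma binom_sum_antidifference f g n :
    x + y != 0 -> f 0%N = 0 -> g 0%N = 0 ->
    (forall k, f k.+1 - f k = g k.+1 / k.+1%:R) ->
  T f n = (x + y) ^+ n *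
          \sum_(1 <= j < n.+1) (x + y) ^- j / j%:R * T g j.
Proof.
move=> s0 f0 g0 fg; elim: n => [|n IHn].
  by rewrite binom_sum0 f0 big_geq ?mulr0.
rewrite binom_sum_diff (eq_binom_sum _ fg) binom_sum_absorb // IHn.
rewrite [in RHS]big_nat_recr //= mulrDr [in RHS]exprS !mulrA; congr (_ + _).
by rewrite -exprS divff ?expf_neq0 // mul1r mulrC.
Qed.

End BinomialTransform.

(** * Harmonic numbers *)

Section Harmonic.
Variable R : realType.
Implicit Types (x y : R) (n : nat).
Local Notation H := (harmonic_num R).
Local Notation H2 := (harmonic_num2 R).

Lemma harmonic_num0 : H 0 = 0. Proof. by rewrite /harmonic_num big_geq. Qed.

Lemma harmonic_num20 : H2 0 = 0. Proof. by rewrite /harmonic_num2 big_geq. Qed.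

Lemma harmonic_numS n : H n.+1 = H n + n.+1%:R^-1.
Proof. by rewrite /harmonic_num big_nat_recr. Qed.

Lemma harmonic_num2S n : H2 n.+1 = H2 n + (n.+1%:R ^+ 2)^-1.
Proof. by rewrite /harmonic_num2 big_nat_recr. Qed.

Lemma binom_sum_inv_harmonic x y n :
  binom_sum x y (fun k => k%:R^-1) n =
  \sum_(1 <= i < n.+1) y ^+ (n - i) * (x + y) ^+ i / i%:R - y ^+ n * H n.
Proof.
rewrite binom_sum_inv /harmonic_num mulr_sumr -sumrB.
apply: eq_big_nat => i /andP[_ lei].
by rewrite mulrBr mulrBl -exprD subnK.
Qed.

Lemma binom_sum_harmonic x y n : x + y != 0 ->
  binom_sum x y H n =
  (x + y) ^+ n * (H n - \sum_(1 <= j < n.+1) y ^+ j * (x + y) ^- j / j%:R).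
Proof.
move=> s0.
rewrite (binom_sum_antidifference (g := fun k => (0 < k)%:R)) ?harmonic_num0 //.
  rewrite /harmonic_num -sumrB; congr (_ * _); apply: eq_bigr => j _.
  rewrite binom_sum_pos mulrBr mulrAC mulVf ?expf_neq0 // mul1r; congr (_ - _).
  by ring.
by move=> k; rewrite harmonic_numS addrC addKr mul1r.
Qed.

Lemma binom_sum_harmonic2 x y n : x + y != 0 ->
  binom_sum x y H2 n =
  (x + y) ^+ n * \sum_(1 <= j < n.+1)
    (x + y) ^- j / j%:R * binom_sum x y (fun k => k%:R^-1) j.
Proof.
move=> s0; apply: binom_sum_antidifference; rewrite ?harmonic_num20 ?invr0 //.
by move=> k; rewrite harmonic_num2S addrC addKr expr2 invfM.
Qed.

Lemma binom_sum_harmonic_sqr x y n : x + y != 0 ->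
  binom_sum x y (fun k => H k ^+ 2) n =
  (x + y) ^+ n * \sum_(1 <= j < n.+1) (x + y) ^- j / j%:R *
    (2 * binom_sum x y H j - binom_sum x y (fun k => k%:R^-1) j).
Proof.
move=> s0.
rewrite (binom_sum_antidifference (g := fun k => 2 * H k - k%:R^-1)) //.
- by under eq_bigr => j _ do rewrite binom_sumB binom_sumZ.
- by rewrite harmonic_num0 expr0n.
- by rewrite harmonic_num0 invr0 mulr0 subrr.
by move=> k; rewrite harmonic_numS; ring.
Qed.

(** Exchanging summations in sum_(i <= j <= n) t_i / (i j) leaves
    sum_i t_i / i * (H_n - H_i + 1/i); for t_i = 1 the same exchange gives
    2 sum_j H_j / j = H_n^2 + H_n^(2). *)
Lemma harmonic_sum_rearrange (t : nat -> R) n :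
  2 * \sum_(1 <= j < n.+1) (H j - \sum_(1 <= i < j.+1) t i / i%:R) / j%:R =
  H n ^+ 2 + H2 n - 2 * \sum_(1 <= j < n.+1) t j / j%:R ^+ 2
  - 2 * H n * \sum_(1 <= j < n.+1) t j / j%:R
  + 2 * \sum_(1 <= j < n.+1) t j / j%:R * H j.
Proof.
elim: n => [|n IHn].
  by rewrite !big_geq // harmonic_num0 harmonic_num20; ring.
rewrite big_nat_recr //= mulrDr IHn.
rewrite !(@big_nat_recr _ _ _ n.+1) //= harmonic_numS harmonic_num2S -exprVn.
by ring.
Qed.

Lemma double_sum_binom_sum_inv x y n :
  \sum_(1 <= j < n.+1)
    (x + y) ^- j / j%:R * binom_sum x y (fun k => k%:R^-1) j =
  double_sum y (x + y) n
  - \sum_(1 <= j < n.+1) y ^+ j * (x + y) ^- j / j%:R * H j.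
Proof.
rewrite /double_sum -sumrB; apply: eq_bigr => j _.
by rewrite binom_sum_inv_harmonic mulrBr; congr (_ - _); ring.
Qed.

End Harmonic.

Theorem corollary1p5 (R : realType) (x y : R) (n : nat)
    (hxy : x + y != 0) (hx : 0 <= x / (x + y)) (hn : (1 <= n)%N) :
  \sum_(0 <= k < n.+1)
      x ^+ k * y ^+ (n - k) * 'C(n, k)%:R * harmonic_num2 R k
    = (x + y) ^+ n *
      (double_sum y (x + y) n
       - \sum_(1 <= j < n.+1) (y ^+ j * (x + y) ^- j / j%:R * harmonic_num R j))
  /\
  \sum_(0 <= k < n.+1)
      x ^+ k * y ^+ (n - k) * 'C(n, k)%:R * harmonic_num R k ^+ 2
    = (x + y) ^+ n *
      (harmonic_num R n ^+ 2 + harmonic_num2 R n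
       - 2 * \sum_(1 <= j < n.+1) (y ^+ j * (x + y) ^- j / j%:R ^+ 2)
       - 2 * harmonic_num R n * \sum_(1 <= j < n.+1) (y ^+ j * (x + y) ^- j / j%:R)
       + 3 * \sum_(1 <= j < n.+1)
               (y ^+ j * (x + y) ^- j / j%:R * harmonic_num R j)
       - double_sum y (x + y) n).
Proof.
split.
  by rewrite -double_sum_binom_sum_inv -binom_sum_harmonic2.
rewrite -/(binom_sum x y (fun k => harmonic_num R k ^+ 2) n).
rewrite binom_sum_harmonic_sqr //; congr (_ * _).
under eq_bigr => j _ do rewrite mulrBr.
rewrite sumrB double_sum_binom_sum_inv.
transitivity (2 * \sum_(1 <= j < n.+1) (harmonic_num R j -
    \sum_(1 <= i < j.+1) y ^+ i * (x + y) ^- i / i%:R) / j%:R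
  - (double_sum y (x + y) n
     - \sum_(1 <= j < n.+1) y ^+ j * (x + y) ^- j / j%:R * harmonic_num R j)).
  congr (_ - _); rewrite mulr_sumr; apply: eq_bigr => j _.
  rewrite binom_sum_harmonic // mulrCA; congr (_ * _).
  by rewrite mulrAC mulKf ?expf_neq0 // mulrC.
rewrite (harmonic_sum_rearrange (fun i => y ^+ i * (x + y) ^- i)).
by ring.
Qed.
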